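(* Let $p_1,p_2$ be distinct primes, $m,l,r\in\mathbb{N}$ with $o_{p_1^m}(r)=p_2^l$, and let $$G=\langle a,b\mid a^{p_1^m}=b^{p_2^l}=1,\ b^{-1}ab=a^r\rangle .$$ Let $q$ be a prime power coprime to $p_1p_2$, let $1\le j_1\le m$ and $1\le\beta\le p_2^l-1$, and let $e_{p_1^{j_1},k_1}$ be a primitive central idempotent of $\mathbb{F}_qG$ corresponding to the strong Shoda pair $(\langle a\rangle,\langle a^{p_1^{j_1}}\rangle)$. Let $\mathcal{C}=\mathbb{F}_qG\,e_{p_1^{j_1},k_1}\widehat{\langle b^\beta\rangle}$ be the associated non-central code, with dimension $\dim$ and minimum distance $d$. Then $$\dim=o_{p_1^{j_1}}(q)\,p_2^{\lambda+\lambda_0}$$ and $$\begin{cases}2p_1^{m-j_1}p_2^{\,l-\lambda}\le d\le p_1^m\,p_2^{\,l-\lambda}, & 1\le j_1\le i_0^{(1)},\\ 2p_1^{m-j_1}p_2^{\,l-\lambda}\le d\le p_1^{\,m-j_1+i_0^{(1)}}\,p_2^{\,l-\lambda}, & \text{otherwise},\end{cases}$$ where $\gcd(\beta,p_2^l)=p_2^\lambda$ and $\gcd(\omega_0,p_2^l)=p_2^{\lambda_0}$.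
   Context: $o_s(x)$ is the multiplicative order of $x$ modulo $s$; $\phi$ is Euler's totient. For a subgroup $X$ of $G$, $\widehat X=\frac1{|X|}\sum_{x\in X}x$. The dimension is over $\mathbb{F}_q$, and the minimum distance of a nonzero left ideal is the minimum number of nonzero coefficients (with respect to the basis $G$) among its nonzero elements. The integer $i_0^{(1)}$ is defined by $o_{p_1^m}(q)=\phi(p_1^m)/\delta_1$ with $\delta_1=p_1^{\,i_0^{(1)}-1}\delta_1'$, $\gcd(\delta_1',p_1)=1$. The integer $\omega_0$ is the least positive integer such that $r^{\omega_0}\in\langle q\rangle\bmod p_1^{j_1}$, where $\langle q\rangle$ is the subgroup of $(\mathbb{Z}/p_1^{j_1})^*$ generated by $q$. The idempotent $e_{p_1^{j_1},k_1}$: let $\xi$ be a primitive $p_1^{j_1}$-th root of unity in $\overline{\mathbb{F}}_q$, $k_1$ an integer coprime to $p_1$, and $\operatorname{tr}$ the trace from $\mathbb{F}_q(\xi)$ to $\mathbb{F}_q$. Put $\epsilon=\frac1{p_1^{j_1}}\widehat{\langle a^{p_1^{j_1}}\rangle}\sum_{i=0}^{p_1^{j_1}-1}\operatorname{tr}(\xi^{k_1i})a^{-i}$. Then $e_{p_1^{j_1},k_1}$ is the sum of the distinct $G$-conjugates of $\epsilon$. *)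

(* Defs.v *)
From HB Require Import structures.
From mathcomp Require Import all_boot all_order all_algebra all_fingroup.
From mathcomp Require Import all_solvable all_field all_character.

Set Implicit Arguments.
Unset Strict Implicit.
Unset Printing Implicit Defensive.

Import GRing.Theory.

Local Open Scope ring_scope.

(* Only meaningful for 1 < s and x coprime to s: the value is 1 for x not
   coprime to s, and 'Z_s has at least two elements. *)
Definition unit_mod (s x : nat) : {unit 'Z_s} := insubd (1%g : {unit 'Z_s}) (x%:R : 'Z_s).

Definition mulord (s x : nat) : nat := #[unit_mod s x]%g.

Definition is_i0 (p m q i0 : nat) : Prop :=
  (0 < i0)%N /\
  exists delta delta' : nat,
    [/\ totient (p ^ m) = (mulord (p ^ m) q * delta)%N,
        delta = (p ^ (i0 - 1) * delta')%N
      & coprime delta' p].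

Definition is_omega0 (s r q w : nat) : Prop :=
  [/\ (0 < w)%N,
      (unit_mod s r ^+ w)%g \in <[unit_mod s q]>%g
    & forall v, (0 < v)%N -> (unit_mod s r ^+ v)%g \in <[unit_mod s q]>%g ->
        (w <= v)%N].

(* The second component makes G abstractly isomorphic to the presented group
   (which is finite); as finite groups are Hopfian, the others then make a and
   b correspond to the two generators of the presentation. *)
Definition metacyclic_presentation (gT : finGroupType) (G : {group gT})
    (a b : gT) (s t r : nat) : Prop :=
  [/\ (<<[set a; b]>> = G)%g,
      (G \isog Grp (x : y : x ^+ s, y ^+ t, x ^ y = x ^+ r))%g
    & [/\ a ^+ s = 1, b ^+ t = 1 & a ^ b = a ^+ r]%g].

(* The trace from F(xi) to F. The sum of the Galois conjugates lies in the
   image of F in L, and its coordinate on the vector 1 is the element of F. *)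
Definition trF (F : finFieldType) (L : splittingFieldType F) (xi x : L) : F :=
  coord [tuple (1 : L)] ord0 (galTrace 1%AS <<1; xi>>%VS x).

(* The group algebra F G is group_ring F G, embedded in the matrices by the
   regular representation: g : G is regular_repr F G g and *m is the
   product of F G. *)
Section GroupAlgebra.

Variables (F : finFieldType) (gT : finGroupType) (G : {group gT}).

Definition hat (X : {set gT}) : 'M[F]_#|G| := #|X|%:R^-1 *: gset_mx F G X.

Definition left_ideal (x : 'M[F]_#|G|) := (group_ring F G *m lin_mulmxr x)%R.

Definition weight (A : 'M[F]_#|G|) : nat :=
  #|[set g in G | gring_row A 0 (gring_index G g) != 0]|.

(* Weights are at most #|G|, so the default value matters only for I = 0. *)
Definition min_distance m (I : 'A[F]_(m, #|G|)) : nat :=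
  \big[minn/#|G|]_(A : 'M[F]_#|G| | (A \in I)%MS && (A != 0)) weight A.

(* s is p_1^{j_1} and k is k_1. *)
Definition epsilon (L : splittingFieldType F) (a : gT) (s : nat) (xi : L)
    (k : int) : 'M[F]_#|G| :=
  s%:R^-1 *: (hat <[a ^+ s]>%g
    *m \sum_(i < s) trF xi (xi ^ (k * i%:Z)) *: regular_repr F G (a ^- i)%g).

(* The sum ranges over the set of conjugates, hence has no repetitions. *)
Definition conj_sum (x : 'M[F]_#|G|) : 'M[F]_#|G| :=
  \sum_(y in [set regular_repr F G g^-1%g *m x *m regular_repr F G g
               | g in G]) y.

Definition idempotent_e (L : splittingFieldType F) (a : gT) (s : nat) (xi : L)
    (k : int) : 'M[F]_#|G| := conj_sum (epsilon a s xi k).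

End GroupAlgebra.

(* Main.v *)
(* Write n = p1^m, s = p1^j1, z = xi^k1, and extend scalars from F to L.  For u
   a unit of Z/s let E_u be the idempotent of L<a> attached to the character
   a |-> z^u.  The trace to F is the sum over the powers of the Frobenius, so
   epsilon = sum of E_u over u in <q>; conjugation by b permutes the E_u through
   multiplication by r^-1, hence e = sum of E_u over u in <q><r>, a set of
   o_s(q) omega0 units.  The elements E_u b^t (average of <b^beta>), for u in
   this set and t < p2^lambda, form a basis of the extended code.

   Lower bound: a codeword is constant on the sets <a^s> g <b^beta>, and its
   coefficients over <a>g sum to 0, so its support contains two such sets.
   Upper bound: the word epsilon * (average of <b^beta>) lies in the code.  As
   (Z/n)^* is cyclic, <q> contains all 1 + k p1^i0, which forces
   tr(z^i) = 0 unless p1^(j1-i0) divides i; so epsilon is supported on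
   <a^(p1^(j1-i0))> when i0 < j1. *)

Require Import Defs.
From HB Require Import structures.
From mathcomp Require Import all_boot all_order all_algebra all_fingroup.
From mathcomp Require Import all_solvable all_field all_character.

Set Implicit Arguments.
Unset Strict Implicit.
Unset Printing Implicit Defensive.

Import GRing.Theory.

Local Open Scope nat_scope.

(** * Units modulo prime powers *)

Lemma val_unit_mod s x : 1 < s -> coprime s x ->
  val (unit_mod s x) = x %% s :> nat.
Proof.
move=> s1 co; rewrite /unit_mod insubdK ?val_Zp_nat //.
by rewrite -topredE /= unitZpE.
Qed.

Lemma val_unitM s (u v : {unit 'Z_s}) : 1 < s ->
  val (u * v)%g = val u * val v %% s :> nat.
Proof. by move=> s1; rewrite -[X in _ = _ %% X](Zp_cast s1). Qed.

Lemma coprime_unit s (u : {unit 'Z_s}) : 1 < s -> coprime s (val u).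
Proof. by move=> s1; rewrite -unitZpE // natr_Zp (valP u). Qed.

Lemma unit_modX s x k : 1 < s -> coprime s x ->
  unit_mod s (x ^ k) = (unit_mod s x ^+ k)%g.
Proof.
move=> s1 co; elim: k => [|k IH].
  apply/val_inj/ord_inj; rewrite val_unit_mod ?coprimen1 // expn0 expg0.
  by rewrite -(val_Zp_nat s1).
apply/val_inj/ord_inj; rewrite expgSr val_unitM // -IH.
by rewrite !val_unit_mod ?coprimeXr // modnMml modnMmr expnSr.
Qed.

Lemma unit_mod_eq s x y : 1 < s -> coprime s x -> coprime s y ->
  (unit_mod s x == unit_mod s y) = (x == y %[mod s]).
Proof.
move=> s1 cx cy; apply/eqP/eqP => [E|E].
  by rewrite -!val_unit_mod // E.
by apply/val_inj/ord_inj; rewrite !val_unit_mod.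
Qed.

Lemma unit_mod1 s : 1 < s -> unit_mod s 1 = 1%g.
Proof. by move=> s1; rewrite -(expn0 1) unit_modX ?coprimen1 // expg0. Qed.

Lemma mulord_dvd s x k : 1 < s -> coprime s x ->
  (mulord s x %| k) = (x ^ k == 1 %[mod s]).
Proof.
move=> s1 co.
by rewrite order_dvdn -unit_modX // -unit_mod1 // unit_mod_eq ?coprimen1 ?coprimeXr.
Qed.

(** When [x] is not coprime to [s], [unit_mod s x] takes its default value 1, whose order is 1. *)
Lemma coprime_mulord s x : 1 < mulord s x -> 1 < s -> coprime s x.
Proof.
move=> o1 s1; rewrite -unitZpE //; apply: contraTT o1 => co.
by rewrite /mulord /unit_mod /insubd insubN ?order1.
Qed.

(** Factor [x ^ p - 1] as [x - 1] times a sum of [p] powers of [x]. Each power is 1 modulo [p], so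
    the sum supplies one more factor [p]. *)
Lemma modn1_expp p j x : prime p -> 0 < j -> x = 1 %[mod p ^ j] ->
  x ^ p = 1 %[mod p ^ j.+1].
Proof.
move=> pp j0; have p1 := prime_gt1 pp.
have pj1 : 1 < p ^ j by rewrite -(exp1n j) ltn_exp2r.
case: x => [|x] /eqP; first by rewrite mod0n modn_small.
rewrite -[x.+1]addn1 -{2}[1]add0n eqn_modDr mod0n => /dvdnP[y Dx].
apply/eqP; rewrite eqn_mod_dvd ?expn_gt0 ?addn1 //.
rewrite subn1 predn_exp /= Dx expnSr -mulnA dvdn_mull //.
rewrite dvdn_pmul2l ?expn_gt0 ?prime_gt0 //.
have Ep : p = \sum_(i < p) 1 by rewrite sum_nat_const card_ord muln1.
apply/eqP; rewrite -[RHS](modnn p) [X in _ = X %% _]Ep -modn_summ -[RHS]modn_summ.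
congr (_ %% _); apply: eq_bigr => i _.
rewrite -modnXm -addn1 -(prednK j0) expnS mulnCA -modnDml modnMr add0n.
by rewrite modnXm exp1n.
Qed.

Lemma modn1_expX p j k x : prime p -> 0 < j -> x = 1 %[mod p ^ j] ->
  x ^ (p ^ k) = 1 %[mod p ^ (j + k)].
Proof.
move=> pp j0 x1; elim: k => [|k IH]; first by rewrite addn0 expn1.
by rewrite expnSr expnM addnS modn1_expp // addn_gt0 j0.
Qed.

(** The units are the automorphism group of a cyclic group of order [p ^ n], whose structure is
    known for odd [p]. *)
Lemma units_Zp_pfactor_cyclic p n : prime p -> odd p -> 0 < n ->
  cyclic (units_Zp (p ^ n)).
Proof.
move=> pp op n0; have p1 := prime_gt1 pp.
have pn1 : 1 < p ^ n by rewrite -(exp1n n) ltn_exp2r.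
have [x ox] : exists x : 'Z_(p ^ n), #[x]%g = p ^ n.
  by exists Zp1; rewrite order_Zp1 Zp_cast.
rewrite -ox (isog_cyclic (Zp_unit_isog x)).
have pX : (p.-group <[x]>)%g by rewrite /pgroup -orderE ox pnatX pnat_id.
have ntX : <[x]>%g != 1%g.
  by rewrite -cardG_gt1 -orderE ox.
have [f [_ [_ cF _ _]]] := cyclic_pgroup_Aut_structure pX (cycle_cyclic x) ntX.
case: eqP => [_ E|_ [t [_ _ _]]].
  by move: cF; rewrite -E.
by rewrite op => -[[cA _] _ _].
Qed.

(** In a cyclic group, one subgroup lies in another as soon as its order divides the other's. The
    order of [x] divides [p ^ (m - i0)], and [Elog], a comparison of [p]-adic valuations in the
    definition of [i0], says that this is the exact [p]-part of the order of [q]. *)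
Lemma mem_cycle_unit_mod p m q i0 x : prime p -> odd p -> 0 < m ->
  coprime (p ^ m) q -> is_i0 p m q i0 -> x = 1 %[mod p ^ i0] ->
  unit_mod (p ^ m) x \in <[unit_mod (p ^ m) q]>%g.
Proof.
move=> pp op m0 coq [i00 [d [d' [Et Ed cd]]]] x1.
have p1 := prime_gt1 pp; have p0 := ltnW p1.
have pm1 : 1 < p ^ m by rewrite -(exp1n m) ltn_exp2r.
have cox : coprime (p ^ m) x.
  rewrite coprime_pexpl // prime_coprime // /dvdn -(prednK i00) in x1 *.
  have := congr1 (modn^~ p) x1; rewrite expnS !modn_dvdm ?dvdn_mulr // => ->.
  by rewrite modn_small.
have N0 : 0 < mulord (p ^ m) q by apply: order_gt0.
have Elog : m.-1 = logn p (mulord (p ^ m) q) + (i0 - 1).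
  move/(congr1 (logn p)): Et; rewrite Ed totient_pfactor //.
  have d0 : 0 < d' by case: (d') cd => //; rewrite /coprime gcd0n => /eqP E; rewrite E in p1.
  have e0 k : 0 < p ^ k by rewrite expn_gt0 p0.
  have pp0 : 0 < p.-1 by rewrite -subn1 subn_gt0.
  rewrite !lognM ?muln_gt0 ?e0 ?d0 // !pfactorK // (@logn_coprime p d') 1?coprime_sym //.
  rewrite addn0 logn_coprime ?add0n // prime_coprime //.
  by apply/negP => /dvdn_leq -/(_ pp0); rewrite leqNgt ltn_predL p0.
have cyc := units_Zp_pfactor_cyclic pp op m0.
rewrite -cycle_subG.
rewrite -(cardSg_cyclic cyc) ?subsetT //.
rewrite -!orderE (@dvdn_trans (p ^ (m - i0))) //.
  rewrite mulord_dvd //; apply/eqP.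
  have im : i0 <= m by rewrite -(prednK m0) Elog -addn1 -addnA subnK // leq_addl.
  by have := modn1_expX (m - i0) pp i00 x1; rewrite subnKC.
rewrite -[#[_]%g]/(mulord _ _) pfactor_dvdn //.
have -> : m - i0 = m.-1 - (i0 - 1) by rewrite -subn1 subnBA ?subnK.
by rewrite Elog addnK.
Qed.

(** * The presented metacyclic group *)

(** The concrete group [Extremal.gtype n t r] of order [n * t] has the same presentation, so each
    group is a homomorphic image of the other. *)
Lemma card_metacyclic_presentation (gT : finGroupType) (G : {group gT})
    (a b : gT) n t r :
  1 < n -> 1 < t -> coprime n r -> r ^ t = 1 %[mod n] ->
  metacyclic_presentation G a b n t r -> #|G| = n * t.
Proof.
move=> n1 t1 co rt [_ isoG _].
have isoM : ([set: Extremal.gtype n t r]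
    \isog Grp (x : y : x ^+ n, y ^+ t, x ^ y = x ^+ r))%g.
  (* The model needs an automorphism of the cyclic group that raises a generator to the power [r]
     and has order dividing [t]; multiplication by the unit [r] is one. *)
  apply: Extremal.Grp => //; pose x : 'Z_n := Zp1.
  have ox : #[x]%g = n by rewrite order_Zp1 Zp_cast.
  pose u := unit_mod #[x]%g r.
  have x1 : 1 < #[x]%g by rewrite ox.
  have cox : coprime #[x]%g r by rewrite ox.
  exists (Zp_unitm u); split.
  - by rewrite -im_Zp_unitm mem_morphim ?inE.
  - rewrite order_dvdn -(morphX (Zp_unit_morphism x)) ?inE // -unit_modX //.
    rewrite -(morph1 (Zp_unit_morphism x)) -unit_mod1 //.
    apply/eqP; congr (Zp_unitm _); apply/eqP.
    by rewrite unit_mod_eq ?coprimen1 ?coprimeXr // ox rt.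
  - rewrite permE cycle_id /= val_unit_mod //.
    by rewrite -[in RHS](expg_mod_order x).
apply/eqP; rewrite mulnC -(Extremal.card r t1 n1) eqn_leq.
apply/andP; split; apply: leq_homg; first by rewrite isoM -isoG homg_refl.
by rewrite isoG -isoM homg_refl.
Qed.

(** The relations only bound the orders of [a] and [b] by divisibility. Since these orders are
    coprime their product is [#|G|], which forces equality in both. *)
Lemma metacyclic_structure (gT : finGroupType) (G : {group gT}) (a b : gT) n t r :
  1 < n -> 1 < t -> coprime n r -> r ^ t = 1 %[mod n] -> coprime n t ->
  metacyclic_presentation G a b n t r ->
  [/\ #[a]%g = n, #[b]%g = t, (<[a]> :&: <[b]> = 1)%g, (<[a]> * <[b]> = G)%g
    & (b \in 'N(<[a]>))%g].
Proof.
move=> n1 t1 co rt cont pres.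
have cG := card_metacyclic_presentation n1 t1 co rt pres.
case: pres => [genG _ [an bt ab]].
have nab : (b \in 'N(<[a]>))%g.
  by rewrite -cycle_subG norms_cycle ab mem_cycle.
have defG : (<[a]> * <[b]> = G)%g.
  by rewrite -norm_joinEr ?cycle_subG // -genG joing_idl joing_idr.
have da : #[a]%g %| n by rewrite order_dvdn an.
have db : #[b]%g %| t by rewrite order_dvdn bt.
have tiab : (<[a]> :&: <[b]> = 1)%g.
  by apply: coprime_TIg; rewrite -!orderE (coprime_dvdl da) // (coprime_dvdr db).
have : #[a]%g * #[b]%g = n * t.
  by rewrite -cG -defG TI_cardMg.
have la := dvdn_leq (ltnW n1) da; have lb := dvdn_leq (ltnW t1) db.
move=> E; have [oa ob] : #[a]%g = n /\ #[b]%g = t.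
  have a0 := order_gt0 a; have t0 := ltnW t1.
  have Ea : #[a]%g = n.
    by apply/eqP; rewrite eqn_leq la -(leq_pmul2r t0) -E (leq_pmul2l a0).
  by split=> //; move/eqP: E; rewrite Ea eqn_pmul2l ?(ltnW n1) // => /eqP->.
by split.
Qed.

(** By Bezout. This replaces [beta] by a divisor of the order of [b]. *)
Lemma cycle_expg (gT : finGroupType) (b : gT) (t beta k : nat) :
  #[b]%g = t -> gcdn beta t = k -> (<[b ^+ beta]> = <[b ^+ k]>)%g.
Proof.
move=> ob <-; apply/eqP; rewrite eqEsubset !cycle_subG.
case: (posnP beta) => [->|b0].
  by rewrite gcd0n -ob expg_order expg0 group1.
apply/andP; split.
  by have /dvdnP[y E] := dvdn_gcdl beta t; rewrite {1}E mulnC expgM mem_cycle.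
have [u v E _] := egcdnP t b0.
suff -> : (b ^+ gcdn beta t = b ^+ (u * beta))%g by rewrite mulnC expgM mem_cycle.
by rewrite E expgD mulnC expgM -ob expg_order expg1n mul1g.
Qed.

(** * Traces of roots of unity *)

Local Open Scope ring_scope.

Lemma sum_cycle (V : nmodType) (gT : finGroupType) (x : gT) (f : gT -> V) :
  \sum_(y in <[x]>%g) f y = \sum_(i < #[x]%g) f (x ^+ i)%g.
Proof.
have -> : <[x]>%g = [set (x ^+ i)%g | i : 'I_#[x]%g].
  apply/setP=> y; apply/idP/imsetP => [/cyclePmin[i lti ->]|[i _ ->]].
    by exists (Ordinal lti).
  exact: mem_cycle.
by rewrite big_imset // => i j _ _ /eqP; rewrite eq_expg_ord // => /eqP.
Qed.

(** The Galois group of F(xi) over F is generated by the Frobenius, which raises roots of unity to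
    the power [#|F|]. *)
Lemma trF_root (F : finFieldType) (L : splittingFieldType F) (xi z : L) (s : nat) :
  (1 < s)%N -> s.-primitive_root xi -> coprime s #|F| ->
  z \in <<1; xi>>%VS -> z ^+ s = 1 ->
  (trF xi z)%:A = \sum_(u in <[unit_mod s #|F|]>%g) z ^+ (val u : 'Z_s).
Proof.
move=> s1 xiP co zE zs; set E := <<1; xi>>%AS.
have sE : (1 <= E)%VS by apply: sub1v.
have -> : (trF xi z)%:A = galTrace 1%AS E z.
  have := galTrace_fixedField 1%AS zE.
  rewrite (galois_fixedField (finField_galois sE)) => zt.
  have zs1 : galTrace 1%AS E z \in <<[tuple (1%R : L)]>>%VS by rewrite span_seq1.
  by rewrite [RHS](coord_span zs1) big_ord_recl big_ord0 addr0.
have [alpha /eqP gen frob] := finField_galois_generator sE.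
rewrite dimv1 expn1 in frob.
have xiE : xi \in E by apply: memv_adjoin.
have frobX i x : x \in E -> (alpha ^+ i)%g x = x ^+ (#|F| ^ i).
  move=> xE; elim: i => [|i IH]; first by rewrite expg0 gal_id expn0.
  by rewrite expgSr galM // IH rmorphXn /= frob // -exprM mulnC -expnSr.
(* An automorphism of F(xi) is determined by its value at [xi], so the [k]-th power of the Frobenius
   is trivial exactly when [#|F| ^ k] is 1 modulo [s]. *)
have oa : #[alpha]%g = mulord s #|F|.
  have dv k : (#[alpha]%g %| k)%N = (mulord s #|F| %| k)%N.
    rewrite mulord_dvd // order_dvdn gal_adjoin_eq ?gen ?mem_cycle ?group1 //.
    by rewrite frobX // gal_id -{2}[xi]expr1 (eq_prim_root_expr xiP).
  by apply/eqP; rewrite eqn_dvd -dv dvdnn dv dvdnn.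
rewrite /galTrace gen !sum_cycle oa; apply: eq_bigr => i _.
rewrite frobX // -unit_modX // val_unit_mod ?coprimeXr //.
by rewrite expr_mod.
Qed.

(** Reduction from Z/n to Z/s: [i0] is defined modulo [p1 ^ m], whereas the trace involves residues
    modulo [p1 ^ j1]. *)
Lemma sub_cycle_unit_mod s n x q : (1 < s)%N -> (s %| n)%N -> (0 < n)%N ->
  coprime n x -> coprime n q -> unit_mod n x \in <[unit_mod n q]>%g ->
  unit_mod s x \in <[unit_mod s q]>%g.
Proof.
move=> s1 sn n0 cx cq /cycleP[k E]; have n1 := leq_trans s1 (dvdn_leq n0 sn).
have csx := coprime_dvdl sn cx; have csq := coprime_dvdl sn cq.
suff -> : unit_mod s x = (unit_mod s q ^+ k)%g by apply: mem_cycle.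
apply/eqP; rewrite -unit_modX // unit_mod_eq ?coprimeXr // -(modn_dvdm _ sn).
rewrite -(modn_dvdm (q ^ k) sn); apply/eqP; congr (_ %% _)%N; apply/eqP.
by rewrite -unit_mod_eq ?coprimeXr // unit_modX // E.
Qed.

Lemma sum_prim_root_eq0 (K : fieldType) (w : K) k :
  w != 1 -> w ^+ k = 1 -> \sum_(i < k) w ^+ i = 0.
Proof.
move=> w1 wk; have /eqP := subrX1 w k; rewrite wk subrr eq_sym mulf_eq0 subr_eq0.
by rewrite (negPf w1) => /eqP.
Qed.

(* T is invariant under raising to the powers 1 + k c, and the average of
   y ^+ (1 + k c) over k < s vanishes as soon as y ^+ c != 1. *)
Lemma sum_orbit_eq0 (K : fieldType) (z : K) s (Q : {group {unit 'Z_s}}) c i :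
  (1 < s)%N -> s.-primitive_root z -> s%:R != 0 :> K ->
  (forall k, coprime s (1 + k * c) /\ unit_mod s (1 + k * c) \in Q) ->
  ~~ (s %| i * c)%N ->
  \sum_(u in Q) z ^+ ((val u : 'Z_s) * i) = 0.
Proof.
move=> s1 zP s0 inQ sic; apply/eqP; rewrite -(mulrI_eq0 _ (mulfI s0)); apply/eqP.
rewrite -[s in s%:R]card_ord mulr_natl -sumr_const.
rewrite (eq_bigr (fun k : 'I_s =>
    \sum_(u in Q) z ^+ ((val u : 'Z_s) * i) * (z ^+ ((val u : 'Z_s) * i * c)) ^+ k)).
  rewrite exchange_big big1 // => u _; rewrite -mulr_sumr sum_prim_root_eq0 ?mulr0 //.
    rewrite -mulnA -(prim_order_dvd zP) Gauss_dvdr //; exact: coprime_unit.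
  by rewrite -exprM mulnC exprM (prim_expr_order zP) expr1n.
move=> k _; have [co kQ] := inQ k.
rewrite (reindex_inj (mulIg (unit_mod s (1 + k * c)))).
apply: eq_big => [u|u uQ]; first by rewrite groupMr.
rewrite -(prim_expr_mod zP) -modnMml val_unitM // val_unit_mod // modn_mod modnMmr.
rewrite modnMml (prim_expr_mod zP) -exprM -exprD; congr (_ ^+ _).
by rewrite mulnDr muln1 mulnDl mulnAC -!mulnA [(k * c)%N]mulnC !mulnA.
Qed.

(** * Coefficients, ranks and weights in group rings *)

Section GroupRingFacts.

Variables (F : fieldType) (gT : finGroupType) (G : {group gT}).
Local Notation aG := (regular_repr F G).
Local Notation R_G := (group_ring F G).

(** In the regular representation the row of 1 in the matrix of [g] is the unit vector at [g], so
    this row lists the coefficients of a group ring element. *)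
Definition coef (g : gT) (A : 'M[F]_#|G|) : F :=
  A (gring_index G 1) (gring_index G g).

Lemma coefZ g c A : coef g (c *: A) = c * coef g A.
Proof. by rewrite /coef mxE. Qed.

Lemma coef_sum g I (r : seq I) (P : pred I) (A : I -> 'M_#|G|) :
  coef g (\sum_(i <- r | P i) A i) = \sum_(i <- r | P i) coef g (A i).
Proof. by rewrite /coef summxE. Qed.

Lemma coef_repr : {in G &, forall g h, coef g (aG h) = (g == h)%:R}.
Proof.
move=> g h Gg Gh; rewrite /coef mxE gring_indexK // mul1g mxE eqxx /=.
by rewrite -(inj_eq (can_inj gring_valK)) !gring_indexK.
Qed.

Lemma coefMr A : {in G &, forall g h, coef g (A *m aG h) = coef (g * h^-1)%g A}.
Proof.
move=> g h Gg Gh; rewrite /coef mxE (bigD1 (gring_index G (g * h^-1))) //=.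
rewrite !mxE eqxx gring_indexK ?groupM ?groupV // mulgKV eqxx mulr1.
rewrite big1 ?addr0 // => k nk; rewrite !mxE eqxx /=.
case: eqP => [E|]; last by rewrite mulr0.
case/eqP: nk; rewrite -(gring_valK k); congr gring_index.
have Gk := enum_valP k; rewrite -[g](gring_indexK (G := G)) // E.
by rewrite gring_indexK ?groupM // mulgK.
Qed.

Lemma group_ringE A : (A \in R_G)%MS -> A = \sum_(x in G) coef x A *: aG x.
Proof.
case/envelop_mxP=> f ->; apply: eq_bigr => x Gx; congr (_ *: _).
rewrite coef_sum (bigD1 x) //= coefZ coef_repr // eqxx mulr1 big1 ?addr0 // => y.
by case/andP=> Gy yx; rewrite coefZ coef_repr // eq_sym (negPf yx) mulr0.
Qed.

Lemma coefMl A : (A \in R_G)%MS ->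
  {in G &, forall g h, coef g (aG h *m A) = coef (h^-1 * g)%g A}.
Proof.
move=> RA g h Gg Gh; rewrite (group_ringE RA) mulmx_sumr !coef_sum.
apply: eq_bigr => x Gx; rewrite -scalemxAr -repr_mxM // !coefZ.
rewrite !coef_repr ?groupM ?groupV //; congr (_ * (_ : bool)%:R).
by apply/eqP/eqP => [->|<-]; rewrite ?mulKg ?mulKVg.
Qed.

Lemma group_ring_mulmx A B : (A \in R_G -> B \in R_G -> A *m B \in R_G)%MS.
Proof. exact: envelop_mxM. Qed.

Lemma left_ideal_memP (x B : 'M_#|G|) :
  reflect (exists2 A, (A \in R_G)%MS & B = A *m x)
          (B \in R_G *m lin_mulmxr x)%MS.
Proof.
apply: (iffP submxP) => [[D E]|[A /submxP[D DA] ->]].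
  exists (vec_mx (D *m R_G)); first by rewrite vec_mxK submxMl.
  by apply: (can_inj mxvecK); rewrite E mulmxA -{1}(vec_mxK (D *m R_G)) mul_vec_lin.
by exists D; rewrite mulmxA -DA mul_vec_lin.
Qed.

(** Each matrix factors through the other: a group ring element is recovered linearly from its row
    of coefficients, and the coefficient row of [g x] is the row of [x] indexed by [g]. *)
Lemma rank_left_ideal (x : 'M_#|G|) : (x \in R_G)%MS ->
  \rank (R_G *m lin_mulmxr x) = \rank x.
Proof.
move=> Rx; apply/eqP; rewrite eqn_leq; apply/andP; split.
  have -> : R_G *m lin_mulmxr x = x *m R_G; last exact: mxrankM_maxl.
  apply/row_matrixP=> i; rewrite !row_mul rowK mul_vec_lin /=.
  apply: (can_inj vec_mxK); rewrite mxvecK.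
  have RAx : (aG (enum_val i) *m x \in R_G)%MS.
    by rewrite group_ring_mulmx // envelop_mx_id // enum_valP.
  rewrite -(gring_rowK RAx) /gring_mx /= gring_row_mul; congr (vec_mx (_ *m _)).
  by rewrite /gring_row rowK gring_indexK // mul1g gring_valK -rowE.
suff {1}-> : x = R_G *m lin_mulmxr x *m lin1_mx (gring_row \o vec_mx).
  exact: mxrankM_maxl.
apply/row_matrixP=> i; rewrite !row_mul rowK mul_vec_lin mul_rV_lin1 /= mxvecK.
rewrite gring_row_mul.
by rewrite /gring_row rowK gring_indexK ?enum_valP // mul1g gring_valK rowE.
Qed.

(** The formula of [hat] over an arbitrary field, so that it can also be used over [L]. *)
Definition avg (X : {set gT}) : 'M[F]_#|G| := #|X|%:R^-1 *: gset_mx F G X.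

Lemma avg_group_ring (X : {set gT}) : X \subset G -> (avg X \in R_G)%MS.
Proof.
move/subsetP=> XG; rewrite linearZ /= scalemx_sub // linear_sum summx_sub // => x Xx.
by rewrite envelop_mx_id // XG.
Qed.

Lemma repr_avg (H : {group gT}) h : H \subset G -> h \in H -> aG h *m avg H = avg H.
Proof.
move/subsetP=> HG Hh; rewrite -scalemxAr; congr (_ *: _).
rewrite mulmx_sumr [RHS](reindex_inj (mulgI h)) /=.
apply: eq_big => [x|x Hx]; first by rewrite groupMl.
by rewrite repr_mxM ?HG.
Qed.

Lemma avg_repr (H : {group gT}) h : H \subset G -> h \in H -> avg H *m aG h = avg H.
Proof.
move/subsetP=> HG Hh; rewrite -scalemxAl; congr (_ *: _).
rewrite mulmx_suml [RHS](reindex_inj (mulIg h)) /=.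
apply: eq_big => [x|x Hx]; first by rewrite groupMr.
by rewrite repr_mxM ?HG.
Qed.

End GroupRingFacts.

(** * Weights and minimum distance *)

Section MinDistance.

Variables (F : finFieldType) (gT : finGroupType) (G : {group gT}).

Lemma weightE (A : 'M[F]_#|G|) : weight A = #|[set g in G | coef g A != 0]|.
Proof. by apply: eq_card => g; rewrite !inE /gring_row mxE. Qed.

(** The bound [k <= #|G|] takes care of the default value of the iterated minimum. *)
Lemma min_distance_ge m (I : 'A[F]_(m, #|G|)) k : (k <= #|G|)%N ->
  (forall A, (A \in I)%MS -> A != 0 -> (k <= weight A)%N) -> (k <= min_distance I)%N.
Proof.
move=> kG H; rewrite /min_distance; elim/big_ind: _ => // [x y kx ky|A /andP[]].
  by rewrite leq_min kx.
exact: H.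
Qed.

Lemma min_distance_le m (I : 'A[F]_(m, #|G|)) A :
  (A \in I)%MS -> A != 0 -> (min_distance I <= weight A)%N.
Proof.
move=> IA A0; rewrite /min_distance -Order.NatOrder.minEnat -Order.NatOrder.leEnat.
by apply: Order.TotalTheory.bigmin_le_cond; rewrite IA.
Qed.

End MinDistance.

(** * Idempotents of the characters of a cyclic subgroup *)

Lemma sum_ord_shift (V : zmodType) (f : nat -> V) n :
  f n = f 0%N -> \sum_(i < n) f i.+1 = \sum_(i < n) f i.
Proof.
move=> fn; apply: (@addrI _ (f 0%N)).
by rewrite -(big_ord_recl n (fun i => f i)) /= big_ord_recr /= fn addrC.
Qed.

(** Multiplication by [w] permutes the residues modulo [n]. *)
Lemma sum_ord_mul_coprime (V : zmodType) (f : nat -> V) n w :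
  (0 < n)%N -> coprime n w -> (forall i, f (i %% n)%N = f i) ->
  \sum_(i < n) f (i * w)%N = \sum_(i < n) f i.
Proof.
move=> n0 co fn; pose h (i : 'I_n) := Ordinal (ltn_pmod (i * w) n0).
rewrite [RHS](reindex_inj (h := h)) => [|i j /(congr1 val)/eqP /=].
  by apply: eq_bigr => i _; rewrite /= fn.
wlog le_ij : i j / (i <= j)%N => [IH E|].
  case: (leqP i j) => [le_ij|/ltnW le_ji]; first exact: IH.
  by apply/esym/IH; rewrite // eq_sym.
rewrite eq_sym eqn_mod_dvd ?leq_mul // -mulnBl Gauss_dvdl // => dv.
apply/ord_inj/eqP; rewrite eqn_leq le_ij /= -subn_eq0.
case: posnP => // p; have := dvdn_leq p dv.
by rewrite leqNgt (leq_ltn_trans (leq_subr _ _)).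
Qed.

Lemma sum_ord_mul (V : zmodType) (f : nat -> V) n s :
  \sum_(i < n * s) f i = \sum_(j < n) \sum_(i < s) f (j * s + i)%N.
Proof.
elim: n => [|n IH]; first by rewrite mul0n !big_ord0.
by rewrite big_ord_recr /= -IH mulSn addnC big_split_ord.
Qed.

Section CharacterIdempotents.

Variables (K : fieldType) (gT : finGroupType) (G : {group gT}) (a : gT).
Variables (s n : nat) (z : K).
Hypotheses (Ga : a \in G) (oa : #[a]%g = n) (sn : (s %| n)%N) (s1 : (1 < s)%N).
Hypotheses (zP : s.-primitive_root z) (nK : n%:R != 0 :> K).

Local Notation aG := (regular_repr K G).
Local Notation R_G := (group_ring K G).
Local Notation unitZ := {unit 'Z_s}.
Local Notation nat_unit u := (nat_of_ord (val (u : unitZ))).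

Definition char_idem (u : unitZ) : 'M[K]_#|G| :=
  n%:R^-1 *: \sum_(i < n) z ^+ (nat_unit u * i) *: aG (a ^- i)%g.

Local Notation E := char_idem.

Let n0 : (0 < n)%N. Proof. by rewrite -oa. Qed.

Let GaX i : (a ^+ i \in G)%g. Proof. exact: groupX. Qed.

Let expzX w i j : (i = j %[mod n])%N -> z ^+ (w * i) = z ^+ (w * j).
Proof.
move=> ij; rewrite -(prim_expr_mod zP) -[RHS](prim_expr_mod zP) -modnMmr.
by rewrite -(modn_dvdm i sn) ij modn_dvdm // modnMmr.
Qed.

Let zn1 w : z ^+ (w * n) = 1.
Proof. by rewrite (expzX w (j := 0)) ?modnn ?mod0n // muln0. Qed.

Let expaX i j : (i = j %[mod n])%N -> (a ^+ i = a ^+ j)%g.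
Proof. by move=> ij; apply/eqP; rewrite eq_expg_mod_order oa ij. Qed.

Lemma char_idem_group_ring u : (E u \in R_G)%MS.
Proof.
rewrite linearZ /= scalemx_sub // linear_sum summx_sub // => i _.
by rewrite linearZ /= scalemx_sub // envelop_mx_id ?groupV.
Qed.

Lemma char_idem_eigen u j : aG (a ^+ j)%g *m E u = z ^+ (nat_unit u * j) *: E u.
Proof.
elim: j => [|j IH]; first by rewrite expg0 repr_mx1 mul1mx muln0 expr0 scale1r.
rewrite expgSr repr_mxM // -mulmxA.
suff -> : aG a *m E u = z ^+ nat_unit u *: E u.
  by rewrite -scalemxAr IH scalerA mulnS exprD.
rewrite -scalemxAr [RHS]scalerA mulrC -scalerA; congr (_ *: _).
(* Multiplication by [a] shifts the index by one; the sum is cyclic because its terms at [n] and 0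
   agree. *)
rewrite -[in LHS](sum_ord_shift (f := fun i => z ^+ (nat_unit u * i) *: aG (a ^- i)%g)); last first.
  congr (_ *: aG (_^-1)%g); first by apply: expzX; rewrite modnn mod0n.
  by apply: expaX; rewrite modnn mod0n.
rewrite mulmx_sumr scaler_sumr; apply: eq_bigr => i _.
rewrite scalerA -exprD -mulnS -scalemxAr -repr_mxM ?groupV //; congr (_ *: aG _).
by rewrite expgSr invMg mulKVg.
Qed.

(** By the eigenvector relation, the product is [E v] times the average of the powers of
    [z ^ u / z ^ v], a geometric sum that vanishes unless the ratio is 1. *)
Lemma char_idem_orth u v : E u *m E v = (u == v)%:R *: E v.
Proof.
have Eai i : aG (a ^- i)%g *m E v = (z ^+ (nat_unit v * i))^-1 *: E v.
  have zi : z ^+ (nat_unit v * i) != 0.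
    by rewrite expf_neq0 // (prim_root_eq0 zP) -lt0n ltnW.
  apply: (scalerI zi); rewrite scalerA mulfV // scale1r.
  by rewrite scalemxAr -char_idem_eigen mulmxA -repr_mxM ?groupV // mulVg repr_mx1 mul1mx.
rewrite {1}/E -scalemxAl mulmx_suml.
under eq_bigr do rewrite -scalemxAl Eai scalerA.
rewrite -scaler_suml scalerA; congr (_ *: _).
case: eqP => [->|ne_uv].
  under eq_bigr => i _ do rewrite mulfV ?expf_neq0 ?(prim_root_eq0 zP) -?lt0n ?(ltnW s1) //.
  by rewrite sumr_const card_ord mulVf.
apply/eqP; rewrite mulf_eq0 invr_eq0 (negPf nK) /=; apply/eqP.
rewrite (eq_bigr (fun i : 'I_n => (z ^+ nat_unit u / z ^+ nat_unit v) ^+ i)) => [|i _]; last first.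
  by rewrite !exprM exprMn exprVn.
apply: sum_prim_root_eq0; last first.
  by rewrite exprMn exprVn -!exprM !zn1 invr1 mulr1.
apply: contra_notN ne_uv => /eqP E1.
have zv0 : z ^+ nat_unit v != 0 by rewrite expf_neq0 // (prim_root_eq0 zP) -lt0n ltnW.
have /eqP : z ^+ nat_unit u = z ^+ nat_unit v.
  by rewrite -[RHS]mulr1 -E1 mulrA (mulrC _ (z ^+ nat_unit u)) mulfK.
rewrite (eq_prim_root_expr zP) => /eqP uv.
have lt_s (w : unitZ) : (nat_unit w < s)%N.
  by rewrite -[X in (_ < X)%N](Zp_cast s1) ltn_ord.
by apply/val_inj/ord_inj; rewrite -(modn_small (lt_s u)) uv modn_small.
Qed.

(** Conjugation replaces [a ^- i] by [a ^- (i * w)]. Reindexing by [i * w] absorbs the factor [w] of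
    [u = v * w] in the exponent of [z]. *)
Lemma char_idem_conj u v g w :
  g \in G -> coprime n w -> (a ^ g = a ^+ w)%g -> u = (v * unit_mod s w)%g ->
  aG g^-1%g *m E u *m aG g = E v.
Proof.
move=> Gg co ag ->; have cos := coprime_dvdl sn co.
rewrite -scalemxAr -scalemxAl; congr (_ *: _); rewrite mulmx_sumr mulmx_suml.
rewrite -(sum_ord_mul_coprime (f := fun i => z ^+ (nat_unit v * i) *: aG (a ^- i)%g) n0 co).
  apply: eq_bigr => i _; rewrite -scalemxAr -scalemxAl -!repr_mxM ?groupM ?groupV //.
  rewrite -mulgA -conjgE conjVg conjXg ag -expgM [(i * w)%N]mulnC; congr (_ *: _).
  rewrite -(prim_expr_mod zP) val_unitM // val_unit_mod // -modnMml modn_mod modnMml.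
  rewrite mulnA -[RHS](prim_expr_mod zP) -[in RHS]modnMml; congr (_ ^+ _).
  by rewrite -modnMml modnMmr.
by move=> i; rewrite (expzX _ (modn_mod i n)) (expaX (modn_mod i n)).
Qed.

(** [E u] is supported on [<[a]>], which contains such a [g] only if [g] is 1. The lemma is applied
    to powers of [b]. *)
Lemma coef_char_idem u g : g \in G -> (<[a]> :&: <[g]> = 1)%g ->
  coef g (E u) = n%:R^-1 * (g == 1)%g%:R.
Proof.
move=> Gg ti; rewrite coefZ coef_sum; congr (_ * _).
rewrite (bigD1 (Ordinal n0)) //= coefZ coef_repr ?groupV // muln0 expr0 mul1r expg0 invg1.
rewrite big1 ?addr0 // => i ni; rewrite coefZ coef_repr ?groupV //.
case: eqP => [gi|]; last by rewrite mulr0.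
have : g \in (<[a]> :&: <[g]>)%g by rewrite inE cycle_id gi groupV mem_cycle.
rewrite ti => /set1gP g1; case/eqP: ni; apply/ord_inj/eqP => /=.
have : (#[a]%g %| i)%N by rewrite order_dvdn -invg_eq1 -gi g1.
rewrite oa => di; case: posnP => // p.
by have := dvdn_leq p di; rewrite leqNgt ltn_ord.
Qed.

Lemma char_idem_neq0 u : E u != 0.
Proof.
apply/eqP => /(congr1 (coef 1%g)) /eqP; rewrite coef_char_idem ?cycle1 ?setIg1 //.
by rewrite eqxx mulr1 /coef mxE invr_eq0 (negPf nK).
Qed.

Lemma sum_cycle_char_idem u : gset_mx K G <[a]>%g *m E u = 0.
Proof.
rewrite /gset_mx sum_cycle mulmx_suml.
under eq_bigr do rewrite char_idem_eigen exprM.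
rewrite -scaler_suml oa sum_prim_root_eq0 ?scale0r //.
  rewrite -(prim_order_dvd zP); apply/negP => dv.
  have := coprime_dvdr dv (coprime_unit u s1).
  by rewrite /coprime gcdnn => /eqP s_1; move: (s1); rewrite s_1.
by rewrite -exprM zn1.
Qed.

Definition idem_sum (X : {set unitZ}) : 'M[K]_#|G| := \sum_(u in X) E u.

Lemma idem_sum_group_ring X : (idem_sum X \in R_G)%MS.
Proof. by rewrite linear_sum summx_sub // => u _; apply: char_idem_group_ring. Qed.

Lemma char_idem_idem_sum u (X : {set unitZ}) : E u *m idem_sum X = (u \in X)%:R *: E u.
Proof.
rewrite mulmx_sumr; under eq_bigr do rewrite char_idem_orth.
case: (boolP (u \in X)) => uX.
  rewrite (bigD1 u) //= eqxx big1 ?addr0 // => v /andP[_ vu].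
  by rewrite eq_sym (negPf vu) scale0r.
rewrite big1 ?scale0r // => v vX; case: eqP => [uv|_]; last by rewrite scale0r.
by rewrite uv vX in uX.
Qed.

Lemma idem_sumM (X Y : {set unitZ}) : X \subset Y -> idem_sum X *m idem_sum Y = idem_sum X.
Proof.
move/subsetP=> XY; rewrite mulmx_suml; apply: eq_bigr => u uX.
by rewrite char_idem_idem_sum XY // scale1r.
Qed.

(** The set [X] can be read off from its idempotent, so distinct sets of characters give distinct
    idempotents. *)
Lemma idem_sum_supp X : [set u | E u *m idem_sum X == E u] = X.
Proof.
apply/setP=> u; rewrite inE char_idem_idem_sum; case: (u \in X).
  by rewrite scale1r eqxx.
by rewrite scale0r eq_sym (negPf (char_idem_neq0 u)).
Qed.

Lemma idem_sum_conj X g w :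
  g \in G -> coprime n w -> (a ^ g = a ^+ w)%g ->
  aG g^-1%g *m idem_sum X *m aG g = idem_sum (X :* (unit_mod s w)^-1)%g.
Proof.
move=> Gg co ag; rewrite mulmx_sumr mulmx_suml.
rewrite /idem_sum (reindex_inj (mulIg (unit_mod s w))) /=.
apply: eq_big => [u|u _]; first by rewrite mem_rcoset invgK.
exact: char_idem_conj co ag _.
Qed.

End CharacterIdempotents.

(** * Rank of the code over the extension field *)

Section NonCentralIdeal.

Variables (K : fieldType) (gT : finGroupType) (G : {group gT}) (a b : gT).
Variables (s n t r kappa : nat) (z : K) (S : {set {unit 'Z_s}}).
Hypotheses (Ga : a \in G) (oa : #[a]%g = n) (sn : (s %| n)%N) (s1 : (1 < s)%N).
Hypotheses (zP : s.-primitive_root z) (nK : n%:R != 0 :> K).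
Hypotheses (Gb : b \in G) (ob : #[b]%g = t) (tiab : (<[a]> :&: <[b]> = 1)%g).
Hypotheses (defG : (<[a]> * <[b]> = G)%g) (ab : (a ^ b = a ^+ r)%g).
Hypotheses (cnr : coprime n r) (kt : (kappa %| t)%N).
Hypotheses (tK : t%:R != 0 :> K).
Hypothesis S_unit_r : (S :* (unit_mod s r)^-1)%g = S.

Local Notation aG := (regular_repr K G).
Local Notation R_G := (group_ring K G).
Local Notation E := (@char_idem K gT G a s n z).
Local Notation H := <[(b ^+ kappa)%g]>%G.
Local Notation Hhat := (avg K G H).
Local Notation e := (idem_sum G a n z S).

Let t0 : (0 < t)%N. Proof. by rewrite -ob. Qed.

Let k0 : (0 < kappa)%N. Proof. exact: dvdn_gt0 t0 kt. Qed.

Let HG : H \subset G. Proof. by rewrite cycle_subG groupX. Qed.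

Let HK : #|H|%:R != 0 :> K.
Proof.
have : (#|H| %| t)%N by rewrite -orderE order_dvdn -expgM mulnC expgM -ob expg_order expg1n.
by case/dvdnP=> c E; move: tK; rewrite E natrM mulf_eq0 negb_or => /andP[].
Qed.

(** Conjugation by [a] fixes every character of [<[a]>], and conjugation by [b] permutes the set [S]
    of characters by [S_unit_r]. *)
Lemma idem_sum_central g : g \in G -> aG g *m e = e *m aG g.
Proof.
have fix_e h w : h \in G -> coprime n w -> (a ^ h = a ^+ w)%g ->
    (S :* (unit_mod s w)^-1)%g = S -> aG h *m e = e *m aG h.
  move=> Gh co ah Sw; have := idem_sum_conj Ga oa sn s1 zP S Gh co ah; rewrite Sw => {1}<-.
  by rewrite !mulmxA -repr_mxM ?groupV // mulgV repr_mx1 mul1mx.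
have com_a : aG a *m e = e *m aG a.
  apply: (fix_e a 1%N) => //; [exact: coprimen1 | by rewrite conjgE mulKg |].
  by rewrite unit_mod1 // invg1 mulg1.
have com_b : aG b *m e = e *m aG b by apply: (fix_e b r).
have comX x i : x \in G -> aG x *m e = e *m aG x ->
    aG (x ^+ i)%g *m e = e *m aG (x ^+ i)%g.
  move=> Gx cx; elim: i => [|i IH]; first by rewrite expg0 repr_mx1 mul1mx mulmx1.
  by rewrite expgSr repr_mxM ?groupX // -mulmxA cx mulmxA IH mulmxA.
move=> Gg; have /mulsgP[_ _ /cycleP[i ->] /cycleP[j ->] ->] : (g \in <[a]> * <[b]>)%g by rewrite defG.
by rewrite repr_mxM ?groupX // -mulmxA comX // mulmxA comX // mulmxA.
Qed.

(** Only the term of [Hhat] at [h = b ^- i * b ^+ j] can contribute. It lies in [H] only if [i] and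
    [j] agree modulo [kappa], as [kappa] divides the order of [b]. *)
Lemma coef_char_idem_avg u i j : (i < kappa)%N -> (j < kappa)%N ->
  coef (b ^+ j)%g (E u *m aG (b ^+ i)%g *m Hhat) =
  (i == j)%:R * (n%:R^-1 * #|H|%:R^-1).
Proof.
move=> ik jk; rewrite -scalemxAr coefZ mulmx_sumr coef_sum.
have GbX k : (b ^+ k)%g \in G by apply: groupX.
have Eh h : h \in H -> coef (b ^+ j)%g (E u *m aG (b ^+ i)%g *m aG h) =
    n%:R^-1 * (h == b ^- i * b ^+ j)%g%:R.
  move=> Hh; have Gh := subsetP HG _ Hh.
  have bh : h \in <[b]>%g by apply: subsetP Hh; rewrite cycle_subG mem_cycle.
  rewrite -mulmxA -repr_mxM // coefMr ?groupM // coef_char_idem //; last first.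
  - apply/trivgP; rewrite -tiab setIS // cycle_subG.
    by rewrite groupM ?groupV ?groupM ?mem_cycle.
  - by rewrite groupM ?groupV ?groupM.
  by rewrite -eq_mulgV1 eq_sym -(inj_eq (mulgI (b ^- i)%g)) mulKg.
rewrite (eq_bigr _ Eh) -mulr_sumr mulrCA mulrA [n%:R^-1 * _]mulrC [RHS]mulrC.
rewrite -!mulrA; congr (_ * (_ * _)).
case: eqP => [->|ne_ij].
  rewrite (bigD1 1%g) //= mulVg eqxx big1 ?addr0 // => h /andP[_ h1].
  by rewrite (negPf h1).
rewrite big1 // => h /cycleP[k ->]; case: eqP => // Ek; case: ne_ij.
have /eqP : (b ^+ (i + kappa * k) = b ^+ j)%g by rewrite expgD expgM Ek mulKVg.
rewrite eq_expg_mod_order ob => /eqP ij.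
have := congr1 (modn^~ kappa) ij; rewrite !modn_dvdm // addnC mulnC modnMDl.
by rewrite !modn_small.
Qed.

Lemma repr_avg_mod i : aG (b ^+ i)%g *m Hhat = aG (b ^+ (i %% kappa))%g *m Hhat.
Proof.
rewrite {1}(divn_eq i kappa) addnC expgD repr_mxM ?groupX // -mulmxA.
by rewrite repr_avg // mulnC expgM mem_cycle.
Qed.

Lemma rank_idem_sum_avg : \rank (e *m Hhat) = (#|S| * kappa)%N.
Proof.
pose D := setX S [set: 'I_kappa].
have -> : (#|S| * kappa)%N = #|D| by rewrite cardsX cardsT card_ord.
pose B (d : {unit 'Z_s} * 'I_kappa) := E d.1 *m aG (b ^+ d.2)%g *m Hhat.
have RHhat : (Hhat \in R_G)%MS by apply: avg_group_ring.
have RE u : (E u \in R_G)%MS by apply: char_idem_group_ring.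
have RaG g : g \in G -> (aG g \in R_G)%MS by apply: envelop_mx_id.
have RB d : (B d \in R_G)%MS by rewrite !group_ring_mulmx ?RaG ?groupX.
pose V := \matrix_(i < #|D|) gring_row (B (enum_val i)).
have HhatHhat : Hhat *m Hhat = Hhat.
  rewrite {1}/avg -scalemxAl mulmx_suml.
  under eq_bigr => h Hh do rewrite repr_avg //.
  by rewrite sumr_const -scaler_nat scalerA mulVf ?scale1r.
have rankV : \rank V = #|D|.
  apply/eqP; apply: inj_row_free => v vV.
  pose A := \sum_i v 0 i *: B (enum_val i).
  have RA : (A \in R_G)%MS.
    by rewrite linear_sum summx_sub // => i _; rewrite linearZ /= scalemx_sub.
  have A0 : A = 0.
    have rowA0 : gring_row A = 0.
      rewrite -vV mulmx_sum_row linear_sum; apply: eq_bigr => i _.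
      by rewrite linearZ /= rowK.
    by rewrite -(gring_rowK RA) rowA0 linear0.
  apply/rowP=> i0; rewrite mxE; case Ed: (enum_val i0) => [u j].
  have := enum_valP i0; rewrite Ed inE /= => /andP[uS _].
  (* Multiplying a linear relation by [E u] keeps only the terms with character [u]; the coefficient
     at [b ^+ j] then isolates a single unknown. *)
  have /eqP : coef (b ^+ j)%g (E u *m A) = 0 by rewrite A0 mulmx0 /coef mxE.
  rewrite mulmx_sumr coef_sum (bigD1 i0) //= -scalemxAr coefZ Ed.
  rewrite /B /= !mulmxA char_idem_orth // eqxx scale1r coef_char_idem_avg //.
  rewrite eqxx mul1r big1 ?addr0.
    by rewrite !mulf_eq0 !invr_eq0 (negPf nK) (negPf HK) !orbF => /eqP.
  move=> i ne_i; rewrite -scalemxAr coefZ !mulmxA char_idem_orth //.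
  rewrite -2!scalemxAl coefZ coef_char_idem_avg //.
  case Ei: (enum_val i) => [u' j'] /=; case: eqP => [Eu|]; last by rewrite mul0r mulr0.
  case: eqP => [Ej|]; last by rewrite mul0r !mulr0.
  case/eqP: ne_i; apply: enum_val_inj.
  by rewrite Ed Ei Eu; congr (_, _); apply: ord_inj.
have eE u : u \in S -> E u *m e = E u.
  by move=> uS; rewrite char_idem_idem_sum // uS scale1r.
rewrite -rankV; apply/eqP; rewrite eqn_leq; apply/andP; split; apply: mxrankS.
  (* A row of [e *m Hhat] is the coefficient row of [a ^+ k * b ^+ l] times [e *m Hhat]. Moving [e]
     to the left of [b ^+ l] and splitting it into the [E u] gives multiples of basis words with
     second index [l %% kappa]. *)
  apply/row_subP=> i.
  have -> : row i (e *m Hhat) = gring_row (aG (enum_val i) *m (e *m Hhat)).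
    by rewrite gring_row_mul /gring_row rowK gring_indexK ?enum_valP // mul1g gring_valK rowE.
  have /mulsgP[_ _ /cycleP[k ->] /cycleP[l ->] ->] : (enum_val i \in <[a]> * <[b]>)%g.
    by rewrite defG enum_valP.
  rewrite repr_mxM ?groupX // -!mulmxA [aG (b ^+ l)%g *m _]mulmxA idem_sum_central ?groupX //.
  rewrite -mulmxA repr_avg_mod mulmx_suml mulmx_sumr linear_sum summx_sub //= => u uS.
  rewrite mulmxA char_idem_eigen // -scalemxAl linearZ /= scalemx_sub //.
  pose d := (u, Ordinal (ltn_pmod l k0)).
  have Dd : d \in D by rewrite inE /= uS inE.
  rewrite -[E u *m _]/(E d.1 *m (aG (b ^+ d.2)%g *m Hhat)) mulmxA -/(B d).
  by rewrite -(enum_rankK_in Dd Dd); apply: eq_row_sub (enum_rank_in Dd d) _; rewrite rowK.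
(* Conversely each [B (u, j)] is unchanged by right multiplication by [e *m Hhat], hence lies in the
   ideal. *)
apply/row_subP=> i; rewrite rowK.
have := enum_valP i; case: (enum_val i) => u j; rewrite inE /= => /andP[uS _].
suff <- : B (u, j) *m (e *m Hhat) = B (u, j) by rewrite gring_row_mul submxMl.
have comH : Hhat *m e = e *m Hhat.
  rewrite -scalemxAl -scalemxAr; congr (_ *: _).
  rewrite mulmx_suml mulmx_sumr; apply: eq_bigr => h Hh.
  by rewrite idem_sum_central // (subsetP HG).
rewrite /B /=; set X := E u *m _.
rewrite -[LHS]mulmxA (mulmxA Hhat e) comH -(mulmxA e) HhatHhat mulmxA; congr (_ *m _).
by rewrite /X -mulmxA idem_sum_central ?groupX // mulmxA eE.
Qed.

End NonCentralIdeal.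

(** * Weights of codewords *)

Lemma coef_neq0 (F : fieldType) (gT : finGroupType) (G : {group gT}) (B : 'M[F]_#|G|) :
  (B \in group_ring F G)%MS -> B != 0 -> exists2 g, g \in G & coef g B != 0.
Proof.
move=> RB; have [/existsP[g /andP[Gg Bg]]|noB] :=
  boolP [exists g, (g \in G) && (coef g B != 0)]; first by exists g.
case/eqP; rewrite (group_ringE RB) big1 // => g Gg.
by move: noB; rewrite negb_exists => /forallP/(_ g); rewrite Gg negbK => /eqP ->; rewrite scale0r.
Qed.

(* Left translation by a subgroup C and right translation by H fix B, so its
   support is a union of sets C g H; the sum of its coefficients over A g0
   vanishes, so that it contains at least two of them. *)
Lemma weight_ge (F : finFieldType) (gT : finGroupType) (G A C H : {group gT})
    (B : 'M[F]_#|G|) :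
  A \subset G -> C \subset A -> H \subset G -> coprime #|A| #|H| ->
  #|C|%:R != 0 :> F -> (B \in group_ring F G)%MS -> B != 0 ->
  {in C, forall c, regular_repr F G c *m B = B} ->
  {in H, forall h, B *m regular_repr F G h = B} ->
  gset_mx F G A *m B = 0 ->
  (2 * #|C| * #|H| <= weight B)%N.
Proof.
move=> AG CA HG coAH CF RB B0 BC BH BA.
have CG := subset_trans CA AG.
have coefC c g : c \in C -> g \in G -> coef (c * g)%g B = coef g B.
  move=> Cc Gg; have Gc := subsetP CG _ Cc.
  by rewrite -[in LHS](BC _ Cc) coefMl ?groupM // mulKg.
have coefH h g : h \in H -> g \in G -> coef (g * h)%g B = coef g B.
  move=> Hh Gg; have Gh := subsetP HG _ Hh.
  by rewrite -[in LHS](BH _ Hh) coefMr ?groupM // mulgK.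
have sumA g : g \in G -> \sum_(x in A) coef (x * g)%g B = 0.
  move=> Gg; have : coef g (gset_mx F G A *m B) = 0 by rewrite BA /coef mxE.
  rewrite mulmx_suml coef_sum => E0; rewrite -[RHS]E0 (reindex_inj invg_inj).
  apply: eq_big => [x|x Ax]; first by rewrite groupV.
  by rewrite coefMl // (subsetP AG) // -groupV.
have [g0 Gg0 Bg0] := coef_neq0 RB B0.
have [x /setDP[Ax nCx] Bx] : exists2 x, x \in A :\: C & coef (x * g0)%g B != 0.
  have [/existsP[x /andP[]]|noX] :=
    boolP [exists x, (x \in A :\: C) && (coef (x * g0)%g B != 0)]; first by exists x.
  have := sumA _ Gg0; rewrite (big_setID C) /= (setIidPr CA) [X in _ + X]big1 => [|x ACx].
    under eq_bigr => c Cc do rewrite coefC //.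
    by rewrite sumr_const addr0 -mulr_natl => /eqP; rewrite mulf_eq0 (negPf CF) (negPf Bg0).
  by move: noX; rewrite negb_exists => /forallP/(_ x); rewrite ACx negbK => /eqP.
rewrite weightE; set W := [set g in G | _].
pose H' := (H :^ g0^-1)%G; pose D := C :|: (C :* x)%g.
have DA : D \subset A.
  by rewrite subUset CA mul_subG // sub1set.
have cardD : #|D| = (2 * #|C|)%N.
  rewrite cardsU card_rcoset (_ : C :&: _ = set0) ?cards0 ?subn0 ?addnn ?mul2n //.
  apply/setP=> y; rewrite !inE mem_rcoset; apply/negP=> /andP[Cy Cyx].
  case/negP: nCx; have -> : x = ((y * x^-1)^-1 * y)%g by rewrite invMg invgK mulgKV.
  by rewrite groupM ?groupV.
have tiAH : (A :&: H' = 1)%g by apply: coprime_TIg; rewrite cardJg.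
rewrite -cardD -(cardJg H g0^-1) -cardsX.
rewrite -(card_in_imset (f := fun y : gT * gT => (y.1 * y.2 * g0)%g)).
  apply/subset_leq_card/subsetP=> _ /imsetP[[d h'] /setXP[/= Dd Hh'] ->].
  have Gd : d \in G by apply: (subsetP AG); apply: (subsetP DA).
  move: Hh'; rewrite mem_conjg invgK => Hh.
  have Gh := subsetP HG _ Hh.
  have -> : (d * h' * g0 = d * g0 * h' ^ g0)%g by rewrite conjgE !mulgA mulgK.
  rewrite inE (groupM (groupM Gd Gg0) Gh) coefH ?(groupM Gd Gg0) //=.
  move: Dd; rewrite in_setU => /orP[Cd|]; first by rewrite coefC.
  case/rcosetP=> c Cc ->; rewrite -mulgA coefC // groupM // (subsetP AG) //.
move=> [d h] [d' h'] /setXP[/= Dd Hh] /setXP[/= Dd' Hh'] /mulIg E.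
have : (d'^-1 * d \in A :&: H')%g.
  rewrite inE groupM ?groupV ?(subsetP DA) //=.
  have -> : (d'^-1 * d = h' * h^-1)%g by rewrite -(mulKg d' h') -E !mulgA mulgK.
  by rewrite groupM ?groupV.
rewrite tiAH => /set1gP dd; have Ed : d = d' by rewrite -(mulKVg d' d) dd mulg1.
by move: E; rewrite Ed => /mulgI ->.
Qed.

(** The support of the product is contained in the set [A * H]. *)
Lemma weight_le (F : finFieldType) (gT : finGroupType) (G A H : {group gT})
    (B : 'M[F]_#|G|) :
  H \subset G -> (forall g, g \in G -> coef g B != 0 -> g \in A) ->
  (weight (B *m avg F G H) <= #|A| * #|H|)%N.
Proof.
move=> HG BA; rewrite weightE.
apply: (@leq_trans #|A * H|%g); last by rewrite mul_cardG leq_pmulr // cardG_gt0.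
apply/subset_leq_card/subsetP=> g; rewrite inE => /andP[Gg].
rewrite -scalemxAr coefZ mulmx_sumr coef_sum mulf_eq0 negb_or => /andP[_].
have [/existsP[h /andP[Hh Bh]]|noH] :=
  boolP [exists h, (h \in H) && (coef (g * h^-1)%g B != 0)].
  move=> _; apply/mulsgP; exists (g * h^-1)%g h; rewrite ?mulgKV //.
  by apply: BA; rewrite // groupM // groupV (subsetP HG).
rewrite big1 ?eqxx // => h Hh; have Gh := subsetP HG _ Hh; rewrite coefMr //.
by move: noH; rewrite negb_exists => /forallP/(_ h); rewrite Hh negbK => /eqP.
Qed.

(** * Invertible integers in F, and the order of the group generated by q and r *)

Lemma natf_neq0_coprime (F : finFieldType) k : coprime k #|F| -> k%:R != 0 :> F.
Proof.
move=> co; have F0 : #|F|%:R = 0 :> F.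
  by rewrite -FinRing.zmodXgE -cardsT expg_cardG ?inE.
case: (posnP k) co => [->|k0 co].
  by rewrite /coprime gcd0n => /eqP E; have := finNzRing_gt1 F; rewrite E.
apply/eqP=> kz; have [u v E _] := egcdnP #|F| k0.
have /eqP := congr1 (fun i => i%:R : F) E.
by rewrite (eqP co) natrD !natrM kz F0 !mulr0 add0r eq_sym oner_eq0.
Qed.

Lemma is_omega0_dvd s r q w k : is_omega0 s r q w ->
  (unit_mod s r ^+ k)%g \in <[unit_mod s q]>%g -> (w %| k)%N.
Proof.
case=> w0 wQ minw kQ; rewrite /dvdn; case: posnP => // p.
have : (w <= k %% w)%N.
  apply: minw p _; move: kQ; rewrite {1}(divn_eq k w) expgD mulnC expgM.
  by rewrite groupMl // groupX.
by rewrite leqNgt ltn_mod w0.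
Qed.

(** The number [w] is the order of the image of [r] in the quotient by [<q>]. *)
Lemma card_mul_cycle_omega0 s r q w : is_omega0 s r q w ->
  #|(<[unit_mod s q]> * <[unit_mod s r]>)%g| = (mulord s q * w)%N.
Proof.
move=> Hw; have [w0 wQ minw] := Hw.
set Q := <[unit_mod s q]>%G; set R := <[unit_mod s r]>%G.
have sRN : R \subset 'N(Q)%g.
  by apply/cents_norm/(sub_abelian_cent2 (units_Zp_abelian s)); apply: subsetT.
have ow : #|R / Q|%g = w.
  have NU : unit_mod s r \in 'N(Q)%g by rewrite -cycle_subG.
  rewrite quotient_cycle // -orderE; apply/eqP; rewrite eqn_dvd order_dvdn -morphX //=.
  rewrite (coset_id wQ) eqxx /=; apply: (is_omega0_dvd Hw).
  apply: coset_idr; first by rewrite groupX.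
  by rewrite morphX //= expg_order.
have := mul_cardG Q R; rewrite -[in LHS](LagrangeI R Q) -card_quotient // ow setIC.
rewrite mulnCA mulnC => /eqP; rewrite eqn_pmul2r ?cardG_gt0 // => /eqP <-.
by [].
Qed.

(** * Descent from L to F *)

Section ScalarExtension.

Variables (F : finFieldType) (L : splittingFieldType F).
Variables (gT : finGroupType) (G : {group gT}).
Local Notation iota := (in_alg L).
Local Notation "x ^L" := (map_mx iota x) (at level 2, format "x ^L").
Local Notation aG := (regular_repr F G).
Local Notation aL := (regular_repr L G).

Lemma map_in_alg_inj k l : injective (fun A : 'M[F]_(k, l) => A^L).
Proof. exact: map_mx_inj. Qed.

Lemma map_repr_alg g : (aG g)^L = aL g.
Proof. exact: map_regular_mx. Qed.

Lemma map_gset_mx (X : {set gT}) : (gset_mx F G X)^L = gset_mx L G X.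
Proof. by rewrite /gset_mx raddf_sum; apply: eq_bigr => x _; apply: map_repr_alg. Qed.

Lemma map_avg (X : {set gT}) : (avg F G X)^L = avg L G X.
Proof. by rewrite /avg map_mxZ map_gset_mx fmorphV rmorph_nat. Qed.

Lemma coef_map g (A : 'M[F]_#|G|) : coef g A^L = iota (coef g A).
Proof. by rewrite /coef mxE. Qed.

Lemma mem_group_ring_map (A : 'M[F]_#|G|) :
  (A^L \in group_ring L G)%MS = (A \in group_ring F G)%MS.
Proof. by rewrite -map_mxvec -(map_group_ring iota) map_submx. Qed.

Variables (a : gT) (s n : nat) (xi : L) (k : int).
Hypotheses (Ga : a \in G) (oa : #[a]%g = n) (sn : (s %| n)%N) (s1 : (1 < s)%N).
Hypotheses (xiP : s.-primitive_root xi) (coF : coprime n #|F|).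
Hypothesis zP : s.-primitive_root (xi ^ k).

Local Notation Q := <[unit_mod s #|F|]>%G.
Local Notation z := (xi ^ k).

Let n0 : (0 < n)%N. Proof. by rewrite -oa. Qed.

Let nL : n%:R != 0 :> L.
Proof. by rewrite -(rmorph_nat iota) fmorph_eq0 natf_neq0_coprime. Qed.

(** Expand each trace over [<q>]. The average over [<[a ^+ s]>] times the sum over [i < s] becomes
    one sum over exponents [j * s + i < n], because [z ^+ s = 1]. *)
Lemma map_epsilon : (epsilon G a s xi k)^L = idem_sum G a n z Q.
Proof.
case/dvdnP: (sn) => n' Dn; have s0 := ltnW s1.
have n'0 : (0 < n')%N by move: n0; rewrite Dn muln_gt0 => /andP[].
have zE : z \in <<1; xi>>%VS.
  have xiE := memv_adjoin 1%AS xi.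
  by case: (k) => i; rewrite /exprz ?rpredV rpredX.
have Eavg : avg L G <[a ^+ s]>%g = n'%:R^-1 *: \sum_(j < n') aL (a ^- (j * s))%g.
  have os : #[(a ^- s)%g]%g = n'.
    by rewrite orderV orderXdiv oa // Dn mulnK.
  rewrite /avg -cycleV -orderE os /gset_mx sum_cycle os; congr (_ *: _).
  by apply: eq_bigr => j _; rewrite mulnC expgM expVgn.
have trE i : (trF xi (xi ^ (k * i%:Z)))%:A = \sum_(u in Q) z ^+ ((val u : 'Z_s) * i).
  rewrite -exprz_exp -exprnP (trF_root s1 xiP) ?(coprime_dvdl sn) ?rpredX //.
    by apply: eq_bigr => u _; rewrite -exprM mulnC.
  by rewrite -exprM mulnC exprM (prim_expr_order zP) expr1n.
rewrite /epsilon map_mxZ map_mxM -[hat _ _ _]/(avg F G _) map_avg fmorphV rmorph_nat.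
rewrite raddf_sum /=; under eq_bigr do rewrite map_mxZ /= trE map_repr_alg scaler_suml.
rewrite exchange_big mulmx_sumr scaler_sumr; apply: eq_bigr => u _.
rewrite Eavg -scalemxAl scalerA -invfM -natrM mulnC -Dn; congr (_ *: _).
rewrite [in RHS]Dn (sum_ord_mul (fun i => z ^+ ((val u : 'Z_s) * i) *: aL (a ^- i)%g)).
rewrite mulmx_suml; apply: eq_bigr => j _; rewrite mulmx_sumr; apply: eq_bigr => i _.
have zjs w : z ^+ (w * (j * s)) = 1.
  by rewrite mulnA mulnC exprM (prim_expr_order zP) expr1n.
rewrite -scalemxAr -repr_mxM ?groupV ?groupX // -invMg -expgD mulnDr exprD zjs.
by rewrite mul1r addnC.
Qed.

(** Up to the factor [n%:R^-1], the inner sum is the coefficient at [a ^- i]. *)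
Lemma coef_idem_sum_neq0 g (X : {set {unit 'Z_s}}) : g \in G ->
  coef g (idem_sum G a n z X) != 0 ->
  exists2 i, g = (a ^- i)%g & \sum_(u in X) z ^+ ((val u : 'Z_s) * i) != 0.
Proof.
move=> Gg; rewrite coef_sum.
under eq_bigr do rewrite coefZ coef_sum mulr_sumr.
rewrite exchange_big => nz.
have [/existsP[i /andP[/eqP gi si]]|noi] := boolP [exists i : 'I_n,
    (g == a ^- i)%g && (\sum_(u in X) z ^+ ((val u : 'Z_s) * i) != 0)].
  by exists i.
case/eqP: nz; rewrite big1 // => i _.
under eq_bigr do rewrite coefZ coef_repr ?groupV ?groupX // mulrCA.
rewrite -mulr_suml; move: noi; rewrite negb_exists => /forallP/(_ i).
rewrite negb_and negbK => /orP[/negPf->|/eqP->]; first by rewrite mulr0 mulr0.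
by rewrite mul0r.
Qed.

Variables (b : gT) (r : nat).
Hypotheses (Gb : b \in G) (defG : (<[a]> * <[b]> = G)%g) (ab : (a ^ b = a ^+ r)%g).
Hypothesis cnr : coprime n r.

Local Notation R := <[unit_mod s r]>%G.

(** The distinct conjugates of epsilon correspond to the distinct cosets of [Q] by elements of [R],
    and these partition [Q * R]. *)
Lemma map_idempotent_e : (idempotent_e G a s xi k)^L = idem_sum G a n z (Q * R)%g.
Proof.
rewrite /idempotent_e /conj_sum; set x := epsilon _ _ _ _ _; set T := [set _ | _ in _].
have abX t : (a ^ (b ^+ t) = a ^+ (r ^ t))%g.
  elim: t => [|t IH]; first by rewrite expg0 conjg1.
  by rewrite expgSr conjgM IH conjXg ab -expgM expnS.
have conj_x g t : g \in G -> (a ^ g = a ^+ (r ^ t))%g ->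
    (aG g^-1%g *m x *m aG g)^L = idem_sum G a n z (Q :* (unit_mod s r ^+ t)^-1)%g.
  move=> Gg ag; rewrite !map_mxM !map_repr_alg map_epsilon.
  rewrite (idem_sum_conj Ga oa sn s1 zP _ Gg _ ag) ?coprimeXr //.
  by rewrite unit_modX // (coprime_dvdl sn).
have conj_aX g : g \in G -> exists t, (a ^ g = a ^+ (r ^ t))%g.
  move=> Gg; have /mulsgP[_ _ /cycleP[i ->] /cycleP[t ->] ->] : (g \in <[a]> * <[b]>)%g.
    by rewrite defG.
  have aa : (a ^ (a ^+ i) = a)%g by rewrite conjgE -expgS expgSr mulKg.
  by exists t; rewrite conjgM aa.
(* [supp] recovers the coset from a conjugate, so the sum over the set of conjugates becomes a sum
   over cosets without repetition. *)
pose supp (y : 'M[F]_#|G|) :=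
  [set u : {unit 'Z_s} | char_idem G a n z u *m y^L == char_idem G a n z u].
have suppT y : y \in T -> y^L = idem_sum G a n z (supp y).
  case/imsetP=> g Gg ->; have [t ag] := conj_aX g Gg.
  by rewrite /supp (conj_x g t) // idem_sum_supp.
have -> : (\sum_(y in T) y)^L = \sum_(X in supp @: T) idem_sum G a n z X.
  rewrite raddf_sum [RHS]big_imset; first by apply: eq_bigr => y /suppT.
  move=> y y' Ty Ty' E; apply: map_in_alg_inj.
  by rewrite (suppT y Ty) (suppT y' Ty') E.
have -> : supp @: T = rcosets Q R.
  apply/setP=> X; apply/imsetP/imsetP => [[_ /imsetP[g Gg ->] ->]|[_ /cycleP[t ->] ->]].
    have [t ag] := conj_aX g Gg; exists ((unit_mod s r ^+ t)^-1)%g.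
      by rewrite groupV mem_cycle.
    by rewrite rcosetE /supp (conj_x g t) // idem_sum_supp.
  (* Conjugation by [b ^+ t'] multiplies the coset by [r ^ (- t')]; this [t'] makes that factor
     equal to [r ^ t]. *)
  pose t' := (#[unit_mod s r]%g.-1 * t)%N.
  exists (aG (b ^+ t')^-1%g *m x *m aG (b ^+ t')%g).
    by apply/imsetP; exists (b ^+ t')%g; rewrite ?groupX.
  rewrite rcosetE /supp (conj_x _ t') ?groupX // idem_sum_supp //; congr (_ :* _)%g.
  by rewrite expgM -invg_expg expVgn invgK.
by rewrite /idem_sum [RHS](set_partition_big _ (rcosets_partition_mul R Q)).
Qed.

Local Notation e := (idempotent_e G a s xi k).

Lemma mulg_cycle_unit_rcoset : ((Q * R) :* (unit_mod s r)^-1 = Q * R)%g.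
Proof. by rewrite -mulgA rcoset_id // groupV cycle_id. Qed.

Lemma epsilon_group_ring : (epsilon G a s xi k \in group_ring F G)%MS.
Proof. by rewrite -mem_group_ring_map map_epsilon idem_sum_group_ring. Qed.

Lemma idempotent_e_group_ring : (e \in group_ring F G)%MS.
Proof. by rewrite -mem_group_ring_map map_idempotent_e idem_sum_group_ring. Qed.

Lemma epsilon_mul_idempotent_e :
  epsilon G a s xi k *m e = epsilon G a s xi k.
Proof.
apply: map_in_alg_inj; rewrite map_mxM map_epsilon map_idempotent_e.
by apply: idem_sumM => //; apply: mulG_subl.
Qed.

Lemma idempotent_e_central A :
  (A \in group_ring F G)%MS -> A *m e = e *m A.
Proof.
move/group_ringE->; rewrite mulmx_suml mulmx_sumr; apply: eq_bigr => g Gg.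
rewrite -scalemxAl -scalemxAr; congr (_ *: _).
apply: map_in_alg_inj; rewrite !map_mxM map_idempotent_e map_repr_alg.
by apply: (idem_sum_central (b := b) (r := r)) => //; apply: mulg_cycle_unit_rcoset.
Qed.

Lemma repr_mul_idempotent_e c : c \in <[a ^+ s]>%g -> aG c *m e = e.
Proof.
case/cycleP=> i ->; apply: map_in_alg_inj.
rewrite map_mxM map_idempotent_e map_repr_alg mulmx_sumr; apply: eq_bigr => u _.
rewrite -expgM (char_idem_eigen Ga oa sn zP) mulnCA exprM (prim_expr_order zP) expr1n.
by rewrite scale1r.
Qed.

Lemma gset_cycle_mul_idempotent_e : gset_mx F G <[a]>%g *m e = 0.
Proof.
apply: map_in_alg_inj; rewrite map_mx0 map_mxM map_idempotent_e map_gset_mx mulmx_sumr.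
by rewrite big1 // => u _; apply: sum_cycle_char_idem.
Qed.

End ScalarExtension.

(** * Dimension of the code and bounds on its minimum distance *)

Local Open Scope nat_scope.
Theorem theorem6p1 (p1 p2 m l r : nat)
  (hp1 : prime p1) (hp2 : prime p2) (hp12 : p1 != p2)
  (hr : mulord (p1 ^ m) r = p2 ^ l)
  (gT : finGroupType) (G : {group gT}) (a b : gT)
  (hG : metacyclic_presentation G a b (p1 ^ m) (p2 ^ l) r)
  (q : nat) (F : finFieldType) (hF : #|F| = q) (hq : coprime q (p1 * p2))
  (j1 : nat) (hj1 : 1 <= j1 <= m)
  (beta : nat) (hbeta : 1 <= beta <= p2 ^ l - 1)
  (L : splittingFieldType F) (xi : L)
  (hxi : (p1 ^ j1).-primitive_root%R xi)
  (k1 : int) (hk1 : coprimez k1 p1%:Z)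
  (i0 : nat) (hi0 : is_i0 p1 m q i0)
  (omega0 : nat) (homega0 : is_omega0 (p1 ^ j1) r q omega0)
  (lambda : nat) (hlambda : gcdn beta (p2 ^ l) = p2 ^ lambda)
  (lambda0 : nat) (hlambda0 : gcdn omega0 (p2 ^ l) = p2 ^ lambda0) :
  let C := left_ideal
    (idempotent_e G a (p1 ^ j1) xi k1 *m hat F G <[(b ^+ beta)%g]>%g)%R in
  let d := min_distance C in
  \rank C = mulord (p1 ^ j1) q * p2 ^ (lambda + lambda0)
  /\ (if j1 <= i0 then
        2 * p1 ^ (m - j1) * p2 ^ (l - lambda) <= d
          <= p1 ^ m * p2 ^ (l - lambda)
      else
        2 * p1 ^ (m - j1) * p2 ^ (l - lambda) <= d
          <= p1 ^ (m - j1 + i0) * p2 ^ (l - lambda)).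
Proof.
move=> C d; set n := p1 ^ m in hr hG *; set t := p2 ^ l in hr hG hbeta hlambda hlambda0 *.
set s := p1 ^ j1 in hxi homega0 C d *.
have [j10 j1m] := andP hj1; have m0 : 0 < m := leq_trans j10 j1m.
have l0 : 0 < l.
  rewrite lt0n; apply: contraTneq hbeta => l0.
  by rewrite /t l0; case: (beta).
have expn_gt1 p k : prime p -> 0 < k -> 1 < p ^ k.
  by move=> pp k0; rewrite -(exp1n k) ltn_exp2r ?prime_gt1.
have n1 : 1 < n by apply: expn_gt1.
have t1 : 1 < t by apply: expn_gt1.
have s1 : 1 < s by apply: expn_gt1.
have sn : s %| n by apply: dvdn_exp2l.
have cnr : coprime n r by apply: coprime_mulord; rewrite ?hr.
have rt : r ^ t = 1 %[mod n] by apply/eqP; rewrite -mulord_dvd // hr.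
have cp12 : coprime p1 p2 by rewrite prime_coprime // dvdn_prime2.
have cnt : coprime n t by rewrite coprimeXl ?coprimeXr.
(* If [p1] were 2, the totient of [n] would be a power of 2, yet the order [p2 ^ l] of [r] divides
   it. *)
have op1 : odd p1.
  have [p12|//] := even_prime hp1; have : t %| totient n.
    by rewrite -hr -card_units_Zp ?(ltnW n1) // order_dvdG ?inE.
  rewrite totient_pfactor // p12 mul1n => /(dvdn_trans (dvdn_exp l0 (dvdnn p2))).
  by rewrite Euclid_dvdX // dvdn_prime2 // eq_sym -p12 (negPf hp12).
have [oa ob tiab defG nab] := metacyclic_structure n1 t1 cnr rt cnt hG.
have [_ _ [_ _ ab]] := hG.
have [Ga Gb] : a \in G /\ b \in G.
  by split; rewrite -cycle_subG -defG ?mulG_subl ?mulG_subr.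
have [cqp1 cqp2] : coprime p1 q /\ coprime p2 q.
  by move: hq; rewrite coprimeMr !(coprime_sym q) => /andP.
have cnq : coprime n q by rewrite coprimeXl.
have csq : coprime s q by rewrite coprimeXl.
have cnF : coprime n #|F| by rewrite hF.
have ctF : coprime t #|F| by rewrite hF coprimeXl.
have zP : s.-primitive_root (xi ^ k1)%R.
  have ck : coprime `|k1| s by rewrite coprimeXr.
  case: (k1) ck => i ck; rewrite /exprz; first by rewrite prim_root_exp_coprime.
  have xi0 : (xi ^+ i.+1 != 0)%R by rewrite expf_neq0 // (prim_root_eq0 hxi) -lt0n ltnW.
  (* For negative [k1] the inverse is a power with exponent [s - 1], which is coprime to [s]. *)
  have -> : (xi ^- i.+1 = xi ^+ i.+1 ^+ s.-1)%R.
    apply: (mulfI xi0); rewrite mulfV // -exprS prednK ?(ltnW s1) //.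
    by rewrite -exprM mulnC exprM (prim_expr_order hxi) expr1n.
  by rewrite !prim_root_exp_coprime // coprime_sym coprimenP // ltnW.
set kappa := p2 ^ lambda.
have kt : kappa %| t by rewrite /kappa -hlambda dvdn_gcdr.
have lel : lambda <= l by move: kt; rewrite dvdn_Pexp2l ?prime_gt1.
have tF : (t%:R != 0 :> F)%R by apply: natf_neq0_coprime.
have tL : (t%:R != 0 :> L)%R by rewrite -(rmorph_nat (in_alg L)) fmorph_eq0.
have nL : (n%:R != 0 :> L)%R.
  by rewrite -(rmorph_nat (in_alg L)) fmorph_eq0 natf_neq0_coprime.
set H := <[(b ^+ kappa)%g]>%G.
have HG : H \subset G by rewrite cycle_subG groupX.
have oH : #|H| = p2 ^ (l - lambda).
  by rewrite -orderE orderXdiv ob // -expnB ?prime_gt0.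
set e := idempotent_e G a s xi k1 in C d *; set eps := epsilon G a s xi k1.
have hatH : hat F G <[(b ^+ beta)%g]>%g = avg F G H.
  by rewrite (cycle_expg ob hlambda).
have RH : (avg F G H \in group_ring F G)%MS by apply: avg_group_ring.
have Re : (e \in group_ring F G)%MS by apply: (idempotent_e_group_ring Ga oa sn s1 hxi cnF zP Gb defG ab cnr).
have Reps : (eps \in group_ring F G)%MS by apply: (epsilon_group_ring Ga oa sn s1 hxi cnF zP).
have memC B : reflect (exists2 A, (A \in group_ring F G)%MS & B = (A *m (e *m avg F G H))%R)
    (B \in C)%MS.
  by rewrite /C hatH; apply: left_ideal_memP.
(* Since [r ^ t] is 1 modulo [s], it lies in [<q>]; hence [omega0] equals its gcd with [t]. *)
have omega0t : omega0 %| t.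
  apply: (is_omega0_dvd homega0); rewrite -unit_modX ?(coprime_dvdl sn) //.
  rewrite (_ : unit_mod s _ = 1%g) ?group1 // -unit_mod1 //; apply/eqP.
  by rewrite unit_mod_eq ?coprimen1 ?coprimeXr ?(coprime_dvdl sn) // -(modn_dvdm _ sn) rt modn_dvdm.
have Eomega0 : omega0 = p2 ^ lambda0 by rewrite -hlambda0; apply/esym/gcdn_idPl.
split.
  (* The rank does not change under extension of scalars, so it can be computed over [L]. *)
  rewrite /C hatH rank_left_ideal ?group_ring_mulmx // -(mxrank_map (in_alg L)).
  rewrite map_mxM map_avg (map_idempotent_e Ga oa sn s1 hxi cnF zP Gb defG ab cnr).
  rewrite (rank_idem_sum_avg Ga oa sn s1 zP nL Gb ob tiab defG ab cnr kt tL (mulg_cycle_unit_rcoset F s r)).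
  rewrite hF (card_mul_cycle_omega0 homega0) Eomega0 -mulnA -expnD; congr (_ * p2 ^ _).
  exact: addnC.
have lower : 2 * p1 ^ (m - j1) * p2 ^ (l - lambda) <= d.
  have Cs : #|<[(a ^+ s)%g]>%g| = p1 ^ (m - j1).
    by rewrite -orderE orderXdiv oa // -expnB ?prime_gt0.
  apply: min_distance_ge => [|B CB B0].
    (* The bound is at most [#|G|] because [2 <= p1] and [1 <= j1]. *)
    rewrite -defG TI_cardMg // -!orderE oa ob leq_mul //; last first.
      by rewrite leq_exp2l ?prime_gt1 // leq_subr.
    rewrite (@leq_trans (p1 ^ 1 * p1 ^ (m - j1))) ?leq_mul ?expn1 ?prime_gt1 //.
    rewrite -[X in X * _]expn1 -expnD leq_exp2l ?prime_gt1 //.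
    by rewrite -{2}(subnKC j1m) leq_add2r.
  have [A RA DB] := memC _ CB.
  (* With the central [e] on the left and the average on the right, both translation invariances of
     [B] are visible. *)
  have {}DB : B = (e *m (A *m avg F G H))%R.
    by rewrite DB mulmxA (idempotent_e_central Ga oa sn s1 hxi cnF zP Gb defG ab cnr RA) mulmxA.
  rewrite -Cs -oH; apply: (@weight_ge _ _ G <[a]>%G <[(a ^+ s)%g]>%G H) => //=.
  - by rewrite cycle_subG.
  - by rewrite cycle_subG mem_cycle.
  - by rewrite -orderE oa oH coprimeXl // coprimeXr.
  - by rewrite Cs natf_neq0_coprime // hF coprimeXl.
  - by rewrite DB !group_ring_mulmx.
  - by move=> c cC; rewrite DB mulmxA (repr_mul_idempotent_e Ga oa sn s1 hxi cnF zP Gb defG ab cnr).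
  - by move=> h hH; rewrite DB -!mulmxA avg_repr.
  - by rewrite DB mulmxA (gset_cycle_mul_idempotent_e Ga oa sn s1 hxi cnF zP Gb defG ab cnr) // mul0mx.
pose w := (eps *m avg F G H)%R.
have Cw : (w \in C)%MS.
  by apply/memC; exists eps; rewrite // mulmxA (epsilon_mul_idempotent_e Ga oa sn s1 hxi cnF zP Gb defG ab cnr).
have w0 : (w != 0)%R.
  (* Over [L], multiplying [w] by [E1] leaves [E1] times the average over [H], whose coefficient at
     1 is the inverse of [n * #|H|]. *)
  apply: contraTneq isT => w0; pose E1 := char_idem G a n (xi ^ k1)%R (1%g : {unit 'Z_s}).
  have : (E1 *m (map_mx (in_alg L) w) = 0)%R by rewrite w0 map_mx0 mulmx0.
  rewrite map_mxM map_avg (map_epsilon Ga oa sn s1 hxi cnF zP) mulmxA.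
  rewrite (char_idem_idem_sum Ga oa sn s1 zP nL) group1 scale1r => /(congr1 (coef (b ^+ 0)%g)).
  have kappa0 : 0 < kappa by rewrite expn_gt0 prime_gt0.
  have := coef_char_idem_avg (xi ^ k1)%R Ga oa Gb ob tiab kt (1%g : {unit 'Z_s}) kappa0 kappa0.
  rewrite {1}expg0 repr_mx1 mulmx1 => -> /eqP; rewrite eqxx mul1r {1}/coef mxE.
  rewrite mulf_eq0 !invr_eq0 (negPf nL) /=.
  by rewrite -(rmorph_nat (in_alg L)) fmorph_eq0 (negPf (natf_neq0_coprime _)) // oH hF coprimeXl.
have dw := min_distance_le Cw w0.
have upper c : (forall g, g \in G -> (coef g eps != 0)%R -> g \in <[(a ^+ c)%g]>%g) ->
    d <= #[(a ^+ c)%g]%g * p2 ^ (l - lambda).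
  by move=> supp; apply: leq_trans dw _; rewrite -oH; apply: weight_le.
have supp_eps g : g \in G -> (coef g eps != 0)%R ->
    exists2 i, g = (a ^- i)%g & (\sum_(u in <[unit_mod s q]>%g)
      (xi ^ k1) ^+ ((val u : 'Z_s) * i) != 0)%R.
  move=> Gg; have <- : (coef g (map_mx (in_alg L) eps) != 0 = (coef g eps != 0))%R.
    by rewrite coef_map fmorph_eq0.
  rewrite (map_epsilon Ga oa sn s1 hxi cnF zP) hF.
  exact: coef_idem_sum_neq0.
case: leqP => [_|i0j1]; rewrite lower /=.
  rewrite (leq_trans (upper 1%N _)) ?expg1 ?oa // => g Gg /(supp_eps _ Gg)[i -> _].
  by rewrite groupV mem_cycle.
have Ec : #[(a ^+ (p1 ^ (j1 - i0)))%g]%g = p1 ^ (m - j1 + i0).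
  have le1 : j1 - i0 <= m by apply: leq_trans (leq_subr _ _) j1m.
  rewrite orderXdiv oa ?dvdn_exp2l // -expnB ?prime_gt0 //; congr (_ ^ _).
  by rewrite subnBA ?(ltnW i0j1) // addnBAC.
rewrite -Ec; apply: upper => g Gg /(supp_eps _ Gg)[i -> ni].
suff /dvdnP[k ->] : p1 ^ (j1 - i0) %| i by rewrite groupV mulnC expgM mem_cycle.
have i00 : 0 < i0 by case: hi0.
(* After scaling by [p1 ^ i0] the claim is that [s] divides [i * p1 ^ i0]; otherwise the trace sum
   vanishes by [sum_orbit_eq0]. *)
rewrite -(@dvdn_pmul2r (p1 ^ i0)) ?expn_gt0 ?prime_gt0 // -expnD subnK ?(ltnW i0j1) //.
apply: contraNT ni => ni; apply/eqP.
apply: (sum_orbit_eq0 s1 zP (c := p1 ^ i0)) => //.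
  by apply: contraNneq nL => s0; case/dvdnP: sn => x ->; rewrite natrM s0 mulr0.
move=> k; have co : coprime p1 (1 + k * p1 ^ i0).
  by rewrite -(prednK i00) expnS mulnCA /coprime addnC mulnC gcdnMDl gcdn1.
split; first by rewrite coprimeXl.
(* Membership in [<q>] is proved modulo [p1 ^ m], where [i0] is defined, and then reduced modulo
   [s]. *)
apply: (sub_cycle_unit_mod s1 sn (ltnW n1)); rewrite ?coprimeXl //.
by apply: (mem_cycle_unit_mod hp1 op1 m0 cnq hi0); rewrite addnC modnMDl.
Qed.
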